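(* Let $q\ge 2$, $\ell\ge 1$, $t\ge 1$, $n\ge 1$ be integers. A code $\mathcal{C}\subset \mathbb{Z}_q^n$ is $t$-tandem duplication (length $\ell$) correcting if and only if it is $t$-tandem deletion (length $\ell$) correcting.
   Context: Words are vectors over $\mathbb{Z}_q$; concatenation is written by juxtaposition and $|\boldsymbol{x}|$ denotes the length of a word. Tandem duplication of length $\ell$ at position $p$ ($0\le p\le |\boldsymbol{x}|-\ell$): if $\boldsymbol{x}=(\boldsymbol{u}\boldsymbol{v}\boldsymbol{w})$ with $|\boldsymbol{u}|=p$, $|\boldsymbol{v}|=\ell$, then $\tau_\ell(\boldsymbol{x},p)=(\boldsymbol{u}\boldsymbol{v}\boldsymbol{v}\boldsymbol{w})$. Tandem deletion of length $\ell$ at position $p$ ($0\le p\le |\boldsymbol{x}|-2\ell$): defined only if $\boldsymbol{x}=(\boldsymbol{u}\boldsymbol{v}\boldsymbol{v}\boldsymbol{w})$ with $|\boldsymbol{u}|=p$, $|\boldsymbol{v}|=\ell$, and then $\tau^D_\ell(\boldsymbol{x},p)=(\boldsymbol{u}\boldsymbol{v}\boldsymbol{w})$. For an error type $\epsilon\in\{\tau_\ell,\tau_\ell^D\}$, the ball $B^\epsilon_t(\boldsymbol{x})$ is the set of all words obtained from $\boldsymbol{x}$ by at most $t$ (possibly zero) successive errors of type $\epsilon$, each applied at a position where it is defined. A code $\mathcal{C}\subset\mathbb{Z}_q^n$ is $t$-tandem duplication (resp. $t$-tandem deletion) correcting (length $\ell$) if for all $\boldsymbol{c}_1,\boldsymbol{c}_2\in\mathcal{C}$,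 $B^\epsilon_t(\boldsymbol{c}_1)\cap B^\epsilon_t(\boldsymbol{c}_2)\ne\emptyset$ implies $\boldsymbol{c}_1=\boldsymbol{c}_2$, with $\epsilon=\tau_\ell$ (resp. $\epsilon=\tau_\ell^D$). *)

(* Defs.v *)
From HB Require Import structures.
From mathcomp Require Import all_boot all_order all_algebra.

Set Implicit Arguments.
Unset Strict Implicit.
Unset Printing Implicit Defensive.

(* Words of arbitrary finite length, since errors change the length. The
   alphabet 'Z_q has q letters only for q >= 2. *)
Definition word (q : nat) := seq 'Z_q.

(* An error type is a partial function of a word and a position, given by its
   graph: [e x p y] means that the error is defined on x at position p and
   yields y. *)
Definition error_type (q : nat) := word q -> nat -> word q -> Prop.

(* The bound p + l <= size x is implied by the decomposition of x. *)
Definition tandem_dup (q l : nat) : error_type q := fun x p y =>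
  exists u v w : word q,
    [/\ x = u ++ v ++ w, size u = p, size v = l & y = u ++ v ++ v ++ w].

(* The bound p + 2 * l <= size x is implied by the decomposition of x. *)
Definition tandem_del (q l : nat) : error_type q := fun x p y =>
  exists u v w : word q,
    [/\ x = u ++ v ++ v ++ w, size u = p, size v = l & y = u ++ v ++ w].

(* [errors e k x y]: y results from x by exactly k successive errors. *)
Fixpoint errors (q : nat) (e : error_type q) (k : nat) (x y : word q) : Prop :=
  if k is k'.+1 then exists (p : nat) (z : word q), e x p z /\ errors e k' z y
  else x = y.

Definition ball (q : nat) (e : error_type q) (t : nat) (x : word q) :
    word q -> Prop :=
  fun y => exists2 k : nat, k <= t & errors e k x y.

Definition correcting (q n : nat) (e : error_type q) (t : nat)
    (C : {set n.-tuple 'Z_q}) : Prop :=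
  forall c1 c2 : n.-tuple 'Z_q, c1 \in C -> c2 \in C ->
    (exists y : word q, ball e t c1 y /\ ball e t c2 y) -> c1 = c2.

(* Main.v *)
(* Length-l duplication and deletion are inverse to each other, and each of the
   two satisfies a diamond property: if x yields y1 and y2 by one error each,
   then y1 = y2 or one further error of the same type leads from both y1 and y2
   to a common word. Tiling diamonds, words in the t-ball of a common word have
   intersecting t-balls; so if two codewords have a common descendant under one
   error type, then, reading the errors backwards, they have a common
   descendant under the other. *)
Require Import Defs.
From mathcomp Require Import all_boot all_order all_algebra.

Set Implicit Arguments.
Unset Strict Implicit.
Unset Printing Implicit Defensive.

Definition diamond (q : nat) (e : error_type q) : Prop :=
  forall x p1 p2 y1 y2, e x p1 y1 -> e x p2 y2 ->
    y1 = y2 \/ exists r1 r2 z, e y1 r1 z /\ e y2 r2 z.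

Lemma diamond_leq (q : nat) (e : error_type q) :
  (forall x p1 p2 y1 y2, p1 <= p2 -> e x p1 y1 -> e x p2 y2 ->
    y1 = y2 \/ exists r1 r2 z, e y1 r1 z /\ e y2 r2 z) ->
  diamond e.
Proof.
move=> H x p1 p2 y1 y2 e1 e2; have [le12|/ltnW le21] := leqP p1 p2.
  exact: H le12 e1 e2.
have [->|[r2 [r1 [z [e2z e1z]]]]] := H _ _ _ _ _ le21 e2 e1; first by left.
by right; exists r1, r2, z.
Qed.

Lemma errors_rcons (q : nat) (e : error_type q) k x y p z :
  errors e k x y -> e y p z -> errors e k.+1 x z.
Proof.
elim: k x => [|k IH] x /=; first by move=> <- exz; exists p, z.
by move=> [p' [x' [exx' ex'y]]] eyz; exists p', x'; split=> //; apply: IH.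
Qed.

Lemma errors_rev (q : nat) (e f : error_type q) :
  (forall x p y, e x p y -> f y p x) ->
  forall k x y, errors e k x y -> errors f k y x.
Proof.
move=> ef; elim=> [|k IH] x y /=; first by [].
by move=> [p [z [/ef fzx /IH fyz]]]; apply: errors_rcons fyz fzx.
Qed.

Lemma ball_step (q : nat) (e : error_type q) t x p z y :
  e x p z -> ball e t z y -> ball e t.+1 x y.
Proof. by move=> exz [k kt ezy]; exists k.+1 => //; exists p, z. Qed.

Lemma ball_refl (q : nat) (e : error_type q) t x : ball e t x x.
Proof. by exists 0. Qed.

Lemma ball_leq (q : nat) (e : error_type q) s t x y :
  s <= t -> ball e s x y -> ball e t x y.
Proof. by move=> st [k ks exy]; exists k => //; apply: leq_trans st. Qed.

(** Induction on [k] pushes the single error across one diamond at a time. If a diamond degenerates,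
    the rest of the chain already leads from [y1] to [y2]. *)
Lemma diamond_strip (q : nat) (e : error_type q) : diamond e ->
  forall k x p y1 y2, e x p y1 -> errors e k x y2 ->
  exists z, ball e k y1 z /\ ball e 1 y2 z.
Proof.
move=> De; elim=> [|k IH] x p y1 y2 exy1 /=.
  move=> <-; exists y1; split; first exact: ball_refl.
  by apply: ball_step exy1 _; apply: ball_refl.
move=> [p' [x' [exx' ex'y2]]].
have [->|[r1 [r2 [z1 [ey1z1 ex'z1]]]]] := De _ _ _ _ _ exy1 exx'.
  by exists y2; split; [exists k | apply: ball_refl].
have [z [z1z y2z]] := IH _ _ _ _ ex'z1 ex'y2.
by exists z; split=> //; apply: ball_step ey1z1 z1z.
Qed.

(** Each error on the way to [y1] is stripped against the whole chain to [y2], which never gets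
    longer; hence the bounds [s] and [t] just change sides. *)
Lemma diamond_ball (q : nat) (e : error_type q) : diamond e ->
  forall s t x y1 y2, ball e s x y1 -> ball e t x y2 ->
  exists z, ball e t y1 z /\ ball e s y2 z.
Proof.
move=> De s t x y1 y2 [j js]; elim: j s js t x y2 => [|j IH] s js t x y2 /=.
  by move=> <- xy2; exists y2; split=> //; apply: ball_refl.
case: s js => // s js [p [x' [exx' ex'y1]]] [k kt exy2].
have [z1 [x'z1 [i i1 y2z1]]] := diamond_strip De exx' exy2.
have [z [y1z z1z]] := IH _ js _ _ _ ex'y1 (ball_leq kt x'z1).
(* The budget for [y2] is now [s.+1]; its extra unit pays for the possible error from [y2] to
   [z1]. *)
exists z; split=> //; case: i i1 y2z1 => [|[|//]] _ /=.
  by move=> ->; apply: ball_leq z1z.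
by move=> [r [z2 [ey2 eq_z2]]]; apply: ball_step ey2 _; rewrite eq_z2.
Qed.

Lemma correcting_rev (q n t : nat) (e f : error_type q)
    (C : {set n.-tuple 'Z_q}) :
  diamond f -> (forall x p y, e x p y -> f y p x) ->
  correcting f t C -> correcting e t C.
Proof.
move=> Df ef corr c1 c2 C1 C2 [y [[k1 k1t y1] [k2 k2t y2]]].
apply: corr => //; apply: (diamond_ball Df (x := y)).
  by exists k1 => //; apply: errors_rev y1.
by exists k2 => //; apply: errors_rev y2.
Qed.

(** Levi's lemma: [r] is the stretch between the two cuts of the same word. *)
Lemma cat_eq_prefix (T : eqType) (u s u' s' : seq T) :
  u ++ s = u' ++ s' -> size u <= size u' ->
  exists2 r, u' = u ++ r & s = r ++ s'.
Proof.
elim: u u' => [|a u IH] [|b u'] //=; first by move=> ->; exists [::].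
  by move=> ->; exists (b :: u').
by move=> [<- eq] le_uu'; have [r -> ->] := IH _ eq le_uu'; exists r.
Qed.

Lemma cat_inj (T : eqType) (u s u' s' : seq T) :
  size u = size u' -> u ++ s = u' ++ s' -> u = u' /\ s = s'.
Proof.
by move=> sz /eqP; rewrite eqseq_cat // => /andP[/eqP-> /eqP->].
Qed.

Lemma tandem_dup_diamond (q l : nat) : diamond (@tandem_dup q l).
Proof.
apply: diamond_leq => x p1 p2 y1 y2 le12.
move=> [u [v [w [-> su sv ->]]]] [u' [v' [w' [eqx su' sv' ->]]]]; right.
have [|r eq_u' eq_s] := cat_eq_prefix eqx; first by rewrite su su'.
(* As [v] and [v'] have equal length, [v] is a prefix of [r ++ v'], so it is still present at
   [size u] after [v'] is duplicated. *)
have [||s eq_rv' _] := @cat_eq_prefix _ v w (r ++ v') w'.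
- by rewrite eq_s catA.
- by rewrite size_cat sv sv' leq_addl.
exists (size (u ++ v ++ r)), (size u), (u ++ v ++ r ++ v' ++ v' ++ w').
split.
  by exists (u ++ v ++ r), v', w'; split=> //; rewrite ?eq_s -!catA.
exists u, v, (s ++ v' ++ w'); split=> //.
  by rewrite eq_u' -catA (catA r) eq_rv' -!catA.
by rewrite (catA r) eq_rv' -!catA.
Qed.

Lemma tandem_del_diamond (q l : nat) : diamond (@tandem_del q l).
Proof.
apply: diamond_leq => x p1 p2 y1 y2 le12.
move=> [u [v [w [-> su sv ->]]]] [u' [v' [w' [eqx su' sv' ->]]]].
have [|r eq_u' eq_s] := cat_eq_prefix eqx; first by rewrite su su'.
have [le_lr|/ltnW lt_rl] := leqP l (size r).
  (* The square of [v'] lies inside [v ++ w] and survives the first deletion, shifted left by [l].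
     The square of [v] survives the second, because [r' ++ v'] starts with [v]. *)
  right; have [|r' eq_r eq_vw] := cat_eq_prefix eq_s; first by rewrite sv.
  have [||s eq_r'v' _] := @cat_eq_prefix _ v w (r' ++ v') (v' ++ w').
  - by rewrite eq_vw !catA.
  - by rewrite size_cat sv sv' leq_addl.
  exists (size (u ++ r')), (size u), (u ++ r' ++ v' ++ w'); split.
    by exists (u ++ r'), v', w'; split=> //; rewrite ?eq_vw -!catA.
  exists u, v, (s ++ w'); split=> //.
    by rewrite eq_u' eq_r -!catA (catA r') eq_r'v' -!catA.
  by rewrite (catA r') eq_r'v' -!catA.
(* Overlapping deletions lie in a common run of period l, so they agree. *)
left; have [|a eq_v eq_t] := cat_eq_prefix (esym eq_s); first by rewrite sv.
have [|b eq_v' eq_vw] := cat_eq_prefix (esym eq_t).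
  by rewrite sv' -sv eq_v size_cat leq_addl.
(* Both [v = r ++ a] and [v' = a ++ b] have length [l]; equal lengths of [r] and [b] then force
   [r = b], making [v'] a rotation of [v]. *)
have szb : size r = size b.
  apply/eqP; rewrite -(eqn_add2r (size a)) -size_cat -eq_v sv.
  by rewrite addnC -size_cat -eq_v' sv'.
move: eq_vw; rewrite eq_v eq_v' -!catA => /(cat_inj szb)[eq_rb].
move=> /(@cat_inj _ a _ a _ erefl)[_ ->].
by rewrite eq_u' eq_rb -!catA.
Qed.

Theorem theorem1 (q l t n : nat) (hq : 2 <= q) (hl : 1 <= l) (ht : 1 <= t)
    (hn : 1 <= n) (C : {set n.-tuple 'Z_q}) :
  correcting (tandem_dup l) t C <-> correcting (tandem_del l) t C.
Proof.
split; apply: correcting_rev.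
- exact: tandem_dup_diamond.
- by move=> x p y [u [v [w [-> <- sv ->]]]]; exists u, v, w.
- exact: tandem_del_diamond.
- by move=> x p y [u [v [w [-> <- sv ->]]]]; exists u, v, w.
Qed.
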